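(* Let $\mathcal I,\mathcal J\subset\{1,\ldots,n\}$ be such that $\mathcal I\cap\mathcal J=\emptyset$ and $\mathcal I\cup\mathcal J=\{1,\ldots,n\}$, and assume that there exists $\rho>0$ such that the following conditions are satisfied. ($N_{\mathcal I}$) There exist $\tilde\xi_i,\xi_{i1},\xi_{i2}\in[0,+\infty)$ such that for every $i\in\mathcal I$ we have $$f_i(t,x_1,\ldots,x_{2n},w)\le\tilde\xi_i|x_i|\quad\text{on }[0,1]\times[-\rho,\rho]^{2n}\times\Bigl[\inf_{u\in\overline K_\rho}w_i[u],\sup_{u\in\overline K_\rho}w_i[u]\Bigr],$$ $$h_{ij}[u]\le\xi_{ij}\|u_i\|_\infty\quad\text{for every }u\in\overline K_\rho\text{ and }j=1,2,$$ and $$\max_{i\in\mathcal I}\Bigl\{\frac{\lambda_i\tilde\xi_i}{m_{i0}}+\sum_{j=1,2}\eta_{ij}\xi_{ij}\|\gamma_{ij}\|_\infty\Bigr\}<1.$$ ($N_{\mathcal J}$) There exist $\tilde\delta_i,\delta_{i1},\delta_{i2}\in[0,+\infty)$ such that for every $i\in\mathcal J$ we have $$f_i(t,x_1,\ldots,x_{2n},w)\ge\tilde\delta_i x_i\quad\text{on }[a_i,b_i]\times\prod_{j=1}^{2n}[\theta_j\rho,\rho]\times\Bigl[\inf_{u\in\overline K_\rho}w_i[u],\sup_{u\in\overline K_\rho}w_i[u]\Bigr],$$ where $\theta_j=0$ if $j=i$ and $\theta_j=-1$ if $j\neq i$, $$h_{ij}[u]\ge\delta_{ij}\|u_i\|_\infty\quad\text{for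 every }u\in\overline K_\rho\text{ and }j=1,2,$$ and $$\min_{i\in\mathcal J}\Bigl\{\frac{\lambda_i\tilde\delta_i\tilde c_i}{M_i}+\sum_{j=1,2}\eta_{ij}c_{ij}\delta_{ij}\|\gamma_{ij}\|_\infty\Bigr\}>1.$$ Then the system $$u_i(t)=\lambda_i\int_0^1k_i(t,s)f_i(s,u(s),u'(s),w_i[u])\,ds+\sum_{j=1,2}\eta_{ij}\gamma_{ij}(t)h_{ij}[u],\quad t\in[0,1],\ i=1,\ldots,n,$$ has at most the zero solution in $\overline K_\rho$ (that is, it has no solution $u\in\overline K_\rho\setminus\{0\}$).
   Context: Let $n\ge1$ be an integer. Write $u=(u_1,\ldots,u_n)$, $u'=(u_1',\ldots,u_n')$, and $\|w\|_\infty=\sup_{t\in[0,1]}|w(t)|$. In $f_i(t,x_1,\ldots,x_{2n},w)$ the variables $x_1,\ldots,x_n$ stand for the values of $u_1,\ldots,u_n$ and $x_{n+1},\ldots,x_{2n}$ for those of $u_1',\ldots,u_n'$. Standing assumptions: (C1) For every $i=1,\ldots,n$, $k_i:[0,1]\times[0,1]\to\mathbb{R}$ is measurable in $s$ for every $t$ and continuous in $t$ for almost every (a.e.) $s$, that is, for every $\tau\in[0,1]$, $\lim_{t\to\tau}|k_i(t,s)-k_i(\tau,s)|=0$ for a.e. $s\in[0,1]$. (C2) For every $i=1,\ldots,n$ there exist a subinterval $[a_i,b_i]\subseteq[0,1]$, a constant $\tilde c_i\in(0,1]$ and a function $\Phi_{i0}\in L^1(0,1)$ such that $|k_i(t,s)|\le\Phi_{i0}(s)$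 for $t\in[0,1]$ and a.e. $s\in[0,1]$, and $k_i(t,s)\ge\tilde c_i\Phi_{i0}(s)$ for $t\in[a_i,b_i]$ and a.e. $s\in[0,1]$. (C3) For every $i$, $\frac{\partial k_i}{\partial t}$ is measurable in $s$ for every $t$, continuous in $t$ except possibly at the point $t=s$ where there can be a jump discontinuity (right and left limits both exist), and there exists $\Phi_{i1}\in L^1(0,1)$ such that $|\frac{\partial k_i}{\partial t}(t,s)|\le\Phi_{i1}(s)$ for $t\in[0,1]$ and a.e. $s\in[0,1]$. (C4) For every $i$, $f_i:[0,1]\times\mathbb{R}^{2n}\times[0,+\infty)\to[0,+\infty)$ is continuous. (C5) For every $i$ and $j=1,2$, $\gamma_{ij}\in C^1[0,1]$ and there is a constant $c_{ij}\in(0,1]$ such that $\gamma_{ij}(t)\ge c_{ij}\|\gamma_{ij}\|_\infty$ for every $t\in[a_i,b_i]$. (C6) For every $i$ and $j=1,2$, $\lambda_i,\eta_{ij}\in[0,+\infty)$. The constants and intervals in (C2), (C5) are fixed. The space $\prod_{i=1}^nC^1[0,1]$ has norm $\|u\|:=\max_i\|u_i\|_{C^1}$, where $\|u_i\|_{C^1}:=\max\{\|u_i\|_\infty,\|u_i'\|_\infty\}$. Let $c_i=\min\{\tilde c_i,c_{i1},c_{i2}\}$, $\tilde K_i:=\{w\in C^1[0,1]:\min_{t\in[a_i,b_i]}w(t)\ge c_i\|w\|_\infty\}$, and let $K:=\prod_{i=1}^n\tilde K_i$ (a cone). (C7) For every $i$ and $j=1,2$, $h_{ij}:K\to[0,+\infty)$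 is continuous and maps bounded sets into bounded sets. (C8) For every $i$, $w_i:K\to[0,+\infty)$ is continuous and maps bounded sets into bounded sets. For $\rho\in(0,\infty)$ let $K_\rho:=\{u\in K:\|u\|<\rho\}$; its closure $\overline K_\rho$ is taken relative to $K$. $\frac1{m_{i0}}:=\sup_{t\in[0,1]}\int_0^1|k_i(t,s)|\,ds$ and $\frac1{M_i}:=\inf_{t\in[a_i,b_i]}\int_{a_i}^{b_i}k_i(t,s)\,ds$. Conditions over an empty index set ($\mathcal I=\emptyset$ or $\mathcal J=\emptyset$) are vacuous. *)

(* Defs.v *)
From HB Require Import structures.
From mathcomp Require Import all_boot all_order all_algebra.
From mathcomp Require Import all_classical all_reals all_analysis.

Set Implicit Arguments.
Unset Strict Implicit.
Unset Printing Implicit Defensive.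
Import Order.TTheory GRing.Theory Num.Theory.
Import numFieldNormedType.Exports.
Local Open Scope classical_set_scope.
Local Open Scope ring_scope.

(* Functions on [0,1] are represented by total functions R -> R of which only
   the restriction to [0,1] matters. *)

Notation leb := completed_lebesgue_measure.

(* Lebesgue (not merely Borel) measurability of w on A: the source of w carries
   the sigma-algebra of the completed Lebesgue measure. *)
Definition lebesgue_measurable_fun (R : realType) (A : set R) (w : R -> R) :=
  measurable_fun (A : set (caratheodory_type
    (mu_ext (@wlength R idfun)))) w.

Section C1space.
Context {R : realType}.
Implicit Types (w : R -> R) (t : R).

Definition diffq01 w t : set_system R :=
  (w s - w t) / (s - t) @[s --> within `[0, 1] t^'].

(* The derivative at t of the restriction of w to [0,1], hence one-sided at the
   endpoints. *)
Definition deriv01 w t : R := lim (diffq01 w t).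

Definition is_C1 w : Prop :=
  (forall t, t \in `[0, 1] -> cvg (diffq01 w t)) /\
  {within `[0, 1], continuous (deriv01 w)}.

Definition supnorm w : R := sup [set `|w t| | t in `[0, 1]].

Definition C1norm w : R := Num.max (supnorm w) (supnorm (deriv01 w)).

Variable n : nat.
Implicit Types u v : 'I_n -> R -> R.

Definition prodnorm u : R := \big[Num.max/0]_(i < n) C1norm (u i).

Definition prodsub u v : 'I_n -> R -> R := fun i t => u i t - v i t.

Definition bounded_subset (B : set ('I_n -> R -> R)) : Prop :=
  exists r : R, forall u, B u -> prodnorm u <= r.

(* h maps K into [0,+oo[, is continuous on K and maps bounded subsets of K to
   bounded sets. Continuity with respect to prodnorm, which is a seminorm on
   total functions, forces h u to depend only on the restrictions to [0,1] of
   the components of u, so h is a functional on a subset of the product of n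
   copies of C^1[0,1]. *)
Definition admissible_functional (K : set ('I_n -> R -> R))
    (h : ('I_n -> R -> R) -> R) : Prop :=
  [/\ forall u, K u -> 0 <= h u,
      forall u, K u -> forall e : R, 0 < e -> exists2 d : R, 0 < d &
        forall v, K v -> prodnorm (prodsub v u) < d -> `|h v - h u| < e &
      forall B : set ('I_n -> R -> R), B `<=` K -> bounded_subset B ->
        exists r : R, forall u, B u -> `|h u| <= r].

Section Cone.
Variables (a b c : 'I_n -> R).

Definition cone1 (i : 'I_n) : set (R -> R) :=
  [set w | is_C1 w /\ c i * supnorm w <= inf [set w t | t in `[a i, b i]]].

Definition cone : set ('I_n -> R -> R) := [set u | forall i, cone1 i (u i)].

Definition cone_ball (rho : R) : set ('I_n -> R -> R) :=
  [set u | cone u /\ prodnorm u < rho].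

(* The closure of cone_ball rho relative to the cone. *)
Definition closed_cone_ball (rho : R) : set ('I_n -> R -> R) :=
  [set u | cone u /\ forall e : R, 0 < e ->
    exists2 v, cone_ball rho v & prodnorm (prodsub u v) < e].

End Cone.

(* The point (u_1(t),...,u_n(t),u_1'(t),...,u_n'(t)) of R^(2n). *)
Definition jet u t : 'rV[R]_(n + n) :=
  row_mx (\row_(j < n) u j t) (\row_(j < n) deriv01 (u j) t).

End C1space.

Section Kernel.
Context {R : realType}.
Implicit Types k : R -> R -> R.

(* The partial derivative of k in its first variable. *)
Definition dkdt k (t s : R) : R := deriv01 (fun x => k x s) t.

(* 1/m_{i0} and 1/M_i for the kernel k = k_i; the second one may be 0. *)
Definition inv_m0 k : R :=
  sup [set \int[leb]_(s in `[0, 1]) `|k t s| | t in `[0, 1]].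

Definition inv_M k (a b : R) : R :=
  inf [set \int[leb]_(s in `[a, b]) k t s | t in `[a, b]].

End Kernel.

(* Main.v *)
Require Import Defs.
From HB Require Import structures.
From mathcomp Require Import all_boot all_order all_algebra.
From mathcomp Require Import all_classical all_reals all_analysis.
From mathcomp Require Import measurable_realfun ring lra.

Set Implicit Arguments.
Unset Strict Implicit.
Unset Printing Implicit Defensive.
Import Order.TTheory GRing.Theory Num.Theory.
Import numFieldNormedType.Exports.
Local Open Scope classical_set_scope.
Local Open Scope ring_scope.

(** Each component of a solution is treated separately, and is forced to vanish
    by comparing a single number attached to it with itself.

    If [i] belongs to [I], that number is the sup norm of [u i].  The
    superposition term is at most [xit i * supnorm (u i)] and the functionals
    are at most [xi i j * supnorm (u i)], so the equation gives
    [`|u i t| <= q * supnorm (u i)] on [0,1], where [q < 1] is the constant of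
    the hypothesis ([hammerstein_norm_le]).  Hence the norm is zero.

    If [i] belongs to [J], that number is the minimum of [u i] over [a i, b i].
    It is nonnegative, since it dominates [c i * supnorm (u i)] in the cone.
    The kernel is nonnegative for [t] in [a i, b i], so the integral over [0,1]
    may be cut down to [a i, b i], where the superposition term is at least
    [deltat i] times the minimum.  At a point where the minimum is attained the
    equation then reads [q * min <= min] with [q > 1] ([hammerstein_ge]), so the
    minimum is zero, and the cone condition with [c i > 0] makes the norm zero.

    For the growth hypotheses to apply, the values and derivatives of a
    member of the closed ball must lie in [-rho, rho]
    ([closed_cone_ball_jet]), and the value of [w i] between the bounds of its
    range, which are meaningful because [w i] maps bounded sets to bounded sets
    ([admissible_functional_range]).  The integrals are manipulated as finite
    quantities because the kernel is dominated by an integrable function and the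
    superposition term is continuous on [0,1]
    ([superposition_within_continuous], [integrable_mul_continuous]). *)

(** * Integrals of functions compared almost everywhere *)

Section AeIntegral.
Context d (T : measurableType d) (R : realType).
Context (mu : {measure set T -> \bar R}).
Implicit Types (D E : set T) (f g k : T -> R).

Lemma integrable_ae_le D f g : measurable D -> measurable_fun D f ->
  mu.-integrable D (EFin \o g) ->
  {ae mu, forall x, D x -> `|f x| <= g x} -> mu.-integrable D (EFin \o f).
Proof.
move=> mD mf ig [N [mN N0 fgN]].
have mEf := (measurable_EFinP D f).2 mf.
apply/(negligible_integrable mN mD mEf N0).
apply: (@le_integrable _ _ _ _ _ _ _ (EFin \o g)).
- exact: measurableD.
- by apply: measurable_funS mEf => // x [].
- move=> x [Dx Nx] /=; rewrite lee_fin.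
  apply: le_trans (ler_norm _).
  by move/subsetCl : fgN; apply.
- exact: (integrableS mD (measurableD mD mN) (@subDsetl _ D N) ig).
Qed.

Lemma le_Rintegral_ae D f g : measurable D ->
  mu.-integrable D (EFin \o f) -> mu.-integrable D (EFin \o g) ->
  {ae mu, forall x, D x -> f x <= g x} ->
  \int[mu]_(x in D) f x <= \int[mu]_(x in D) g x.
Proof.
move=> mD fi gi [N [mN N0 fgN]].
have mDN : measurable (D `\` N) by exact: measurableD.
rewrite /Rintegral (negligible_integral mN mD fi N0).
rewrite (negligible_integral mN mD gi N0).
apply: le_Rintegral => //.
- exact: (integrableS mD mDN (@subDsetl _ D N) fi).
- exact: (integrableS mD mDN (@subDsetl _ D N) gi).
- by move=> x [Dx Nx]; move/subsetCl : fgN; apply.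
Qed.

Lemma Rintegral_ae_ge0 D E k : measurable D -> measurable E -> E `<=` D ->
  mu.-integrable D (EFin \o k) -> {ae mu, forall x, D x -> 0 <= k x} ->
  0 <= \int[mu]_(x in E) k x.
Proof.
move=> mD mE ED ki k0.
have kiE : mu.-integrable E (EFin \o k) := integrableS mD mE ED ki.
rewrite -[leLHS](mul0r (\int[mu]_(x in E) k x)) -RintegralZl//.
apply: le_Rintegral_ae => //; first exact: integrableZl kiE.
by apply: filterS k0 => x k0 Ex; rewrite mul0r k0//; exact: ED.
Qed.

(** The envelope [Phi] dominates an absolute value, so it is nonnegative, and a
    kernel above a nonnegative multiple of it inherits the sign. *)
Lemma ae_ge0_of_envelope D k Phi (c : R) : 0 <= c ->
  {ae mu, forall x, D x -> `|k x| <= Phi x} ->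
  {ae mu, forall x, D x -> c * Phi x <= k x} ->
  {ae mu, forall x, D x -> 0 <= k x}.
Proof.
move=> c0; apply: filterS2 => x kP Pk Dx; apply: le_trans (Pk Dx).
by rewrite mulr_ge0// (le_trans _ (kP Dx)).
Qed.

Lemma normr_Rintegral_mul_le D k g C : measurable D ->
  mu.-integrable D (EFin \o k) ->
  mu.-integrable D (EFin \o (fun x => k x * g x)) ->
  (forall x, D x -> `|g x| <= C) ->
  `|\int[mu]_(x in D) (k x * g x)| <= C * \int[mu]_(x in D) `|k x|.
Proof.
move=> mD ki kgi gC.
have aki : mu.-integrable D (EFin \o (fun x => `|k x|)).
  exact: integrable_abse ki.
rewrite (le_trans (le_normr_Rintegral mD kgi))// -RintegralZl//.
apply: le_Rintegral => //.
- exact: integrable_abse kgi.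
- exact: integrableZl aki.
- by move=> x Dx; rewrite normrM mulrC ler_wpM2r// gC.
Qed.

(** Discarding [D `\` E] costs nothing because the integrand is nonnegative
    there. *)
Lemma Rintegral_mul_ge D E k g C : measurable D -> measurable E -> E `<=` D ->
  mu.-integrable D (EFin \o k) ->
  mu.-integrable D (EFin \o (fun x => k x * g x)) ->
  {ae mu, forall x, D x -> 0 <= k x} ->
  (forall x, D x -> 0 <= g x) -> (forall x, E x -> C <= g x) ->
  C * \int[mu]_(x in E) k x <= \int[mu]_(x in D) (k x * g x).
Proof.
move=> mD mE ED ki kgi k0 g0 gC.
have kiE : mu.-integrable E (EFin \o k) by exact: integrableS ki.
have kgiE := integrableS mD mE ED kgi.
apply: (@le_trans _ _ (\int[mu]_(x in E) (k x * g x))).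
  rewrite -RintegralZl//; apply: le_Rintegral_ae => //.
    exact: integrableZl kiE.
  apply: filterS k0 => x k0 Ex.
  by rewrite mulrC ler_wpM2l ?gC// k0//; exact: ED.
rewrite -[in leLHS](setIidr ED) Rintegral_mkcondr.
apply: le_Rintegral_ae => //.
  by rewrite -restrict_EFin; apply/integrable_restrict => //; rewrite setIidr.
apply: filterS k0 => x k0 Dx; rewrite patchE; case: ifPn => // _.
by rewrite mulr_ge0 ?k0 ?g0.
Qed.

End AeIntegral.

(** * Continuously differentiable functions on [0,1] *)

Section C1Functions.
Context (R : realType).
Implicit Types (v w : R -> R) (t : R).

(** Every point of [0,1] is a limit point of [0,1], so limits of difference
    quotients there are unique. *)
Lemma dnbhs01_proper t : t \in `[0, 1] -> ProperFilter (within `[0, 1] t^').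
Proof.
move=> t01; apply: Build_ProperFilter_ex => P /nbhs_ballP[e /= e0 eP].
(* The step goes inwards: to the right from the left half of [0,1], to the left
   from the right half. *)
pose s := Num.min (e / 2) (1 / 2).
have s0 : 0 < s by rewrite lt_min; apply/andP; split; lra.
have se : s <= e / 2 by rewrite ge_min lexx.
have s1 : s <= 1 / 2 by rewrite ge_min lexx orbT.
move: t01; rewrite in_itv/= => /andP[t0 t1].
have [th|th] := leP t (1/2).
- exists (t + s); apply: eP => /=.
  + by rewrite /ball/= opprD addNKr normrN gtr0_norm//; lra.
  + by apply/eqP; lra.
  + by rewrite in_itv/=; lra.
- exists (t - s); apply: eP => /=.
  + by rewrite /ball/= opprD addNKr opprK gtr0_norm//; lra.
  + by apply/eqP; lra.
  + by rewrite in_itv/=; lra.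
Qed.

(** Near [t], [w s - w t] is the difference quotient, which converges, times
    [s - t], which tends to [0]. *)
Lemma is_C1_continuous w : is_C1 w -> {within `[0, 1], continuous w}.
Proof.
move=> [dw _]; apply/subspace_continuousP => t t01; apply/cvgrPdist_lt => e e0.
have {}dw : (w s - w t) / (s - t) @[s --> within `[0, 1] t^'] --> deriv01 w t.
  exact: dw.
have PF := dnbhs01_proper t01.
have idt : s - t @[s --> within `[0, 1] t^'] --> t - t.
  apply: cvgB; last exact: cvg_cst.
  by apply: cvg_within_filter; exact: cvg_within.
have : (w s - w t) / (s - t) * (s - t) @[s --> within `[0, 1] t^']
    --> deriv01 w t * (t - t) by exact: cvgM dw idt.
rewrite subrr mulr0 => /cvgrPdist_lt/(_ _ e0).
rewrite !near_withinE => quot_lt; near=> s => /= s01.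
have [->|st] := eqVneq s t; first by rewrite subrr normr0.
suff : `|0 - (w s - w t) / (s - t) * (s - t)| < e.
  by rewrite divfK ?subr_eq0// sub0r opprB.
by move: st s01; near: s.
Unshelve. all: by end_near. Qed.

Lemma diffq01B_cvg v w t : is_C1 v -> is_C1 w -> t \in `[0, 1] ->
  diffq01 (fun s => v s - w s) t --> deriv01 v t - deriv01 w t.
Proof.
move=> vC wC t01; have PF := dnbhs01_proper t01.
rewrite /diffq01 [X in X @ _](_ : _ =
    (fun s => (v s - v t) / (s - t) - (w s - w t) / (s - t))); last first.
  by apply/funext => s; rewrite -mulrBl; congr (_ / _); ring.
by apply: cvgB; [exact: vC.1|exact: wC.1].
Qed.

Lemma deriv01B v w t : is_C1 v -> is_C1 w -> t \in `[0, 1] ->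
  deriv01 (fun s => v s - w s) t = deriv01 v t - deriv01 w t.
Proof.
move=> vC wC t01; have PF := dnbhs01_proper t01.
by apply: cvg_lim => //; exact: diffq01B_cvg.
Qed.

Lemma is_C1B v w : is_C1 v -> is_C1 w -> is_C1 (fun s => v s - w s).
Proof.
move=> vC wC; split => [t t01|].
  by apply: cvgP; exact: diffq01B_cvg.
apply: (@subspace_eq_continuous _ _ _ (fun t => deriv01 v t - deriv01 w t)).
  by move=> t /set_mem t01; rewrite [LHS]/= -deriv01B.
by apply: within_continuousB; [exact: vC.2|exact: wC.2].
Qed.

Lemma ler_supnorm w t : {within `[0, 1], continuous w} -> t \in `[0, 1] ->
  `|w t| <= supnorm w.
Proof.
move=> wc t01; have : has_sup [set `|w t| | t in `[0, 1]].
  apply: compact_has_sup; first by exists `|w t|, t.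
  apply: continuous_compact; last exact: segment_compact.
  by apply: within_continuous_comp wc => x _; exact: norm_continuous.
by move/sup_upper_bound; apply; exists t.
Qed.

Lemma supnorm_le w r :
  (forall t, t \in `[0, 1] -> `|w t| <= r) -> supnorm w <= r.
Proof.
move=> wr; apply: ge_sup; last by move=> _ [t t01 <-]; exact: wr.
by exists `|w 0|, 0 => //=; rewrite in_itv/= lexx ler01.
Qed.

Lemma ler_prodnorm n (u : 'I_n -> R -> R) i t :
  is_C1 (u i) -> t \in `[0, 1] ->
  `|u i t| <= prodnorm u /\ `|deriv01 (u i) t| <= prodnorm u.
Proof.
move=> uC t01; have C1u : C1norm (u i) <= prodnorm u by exact: le_bigmax.
split; apply: le_trans C1u; rewrite le_max ler_supnorm ?orbT//.
- exact: is_C1_continuous.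
- exact: uC.2.
Qed.

End C1Functions.

(** * The closed ball of the cone *)

Section ClosedConeBall.
Context (R : realType) (n : nat) (a b c : 'I_n -> R) (rho : R).
Implicit Types (u : 'I_n -> R -> R).
Local Notation Kb := (closed_cone_ball a b c rho).

Lemma cone_ge u i t : 0 <= a i -> b i <= 1 -> cone a b c u ->
  t \in `[a i, b i] -> c i * supnorm (u i) <= u i t.
Proof.
move=> a0 b1 /(_ i)[uC min_ge] tab; apply: (le_trans min_ge).
apply: ge_inf; last by exists t.
exists (- supnorm (u i)) => _ [s sab <-].
have s01 : s \in `[0, 1].
  move: sab; rewrite /= !in_itv/= => /andP[as_ sb].
  by rewrite (le_trans a0 as_) (le_trans sb b1).
have := ler_supnorm (is_C1_continuous uC) s01.
by rewrite ler_norml => /andP[].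
Qed.

(** A point of the closure is a point [v] of the open ball up to an error of
    arbitrarily small norm, and the norm of [v] is below [rho]. *)
Lemma closed_cone_ball_jet u t l : Kb u -> t \in `[0, 1] ->
  `|jet u t ord0 l| <= rho.
Proof.
move=> [uK u_lim] t01; apply/ler_addgt0Pr => e e0.
have [v [vK v_rho] uv_e] := u_lim e e0.
have uvC j : is_C1 (prodsub u v j).
  by apply: is_C1B; [exact: (uK j).1|exact: (vK j).1].
case: (split_ordP l) => j ->; rewrite /jet ?row_mxEl ?row_mxEr mxE.
- have [uvj _] := ler_prodnorm (uvC j) t01.
  have [vj _] := ler_prodnorm (vK j).1 t01.
  have -> : u j t = v j t + prodsub u v j t by rewrite /prodsub; ring.
  rewrite (le_trans (ler_normD _ _))// lerD// ltW//.
    exact: le_lt_trans v_rho.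
  exact: le_lt_trans uv_e.
- have [_ uvj] := ler_prodnorm (uvC j) t01.
  have [_ vj] := ler_prodnorm (vK j).1 t01.
  have -> : deriv01 (u j) t = deriv01 (v j) t + deriv01 (prodsub u v j) t.
    have /= -> := deriv01B (uK j).1 (vK j).1 t01; ring.
  rewrite (le_trans (ler_normD _ _))// lerD// ltW//.
    exact: le_lt_trans v_rho.
  exact: le_lt_trans uv_e.
Qed.

Lemma closed_cone_ball_bounded : 0 <= rho -> bounded_subset Kb.
Proof.
move=> rho0; exists rho => u Ku; apply: bigmax_le => // i _.
rewrite ge_max; apply/andP; split; apply: supnorm_le => t t01.
- have := closed_cone_ball_jet (lshift n i) Ku t01.
  by rewrite /jet row_mxEl mxE.
- have := closed_cone_ball_jet (rshift n i) Ku t01.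
  by rewrite /jet row_mxEr mxE.
Qed.

(** Boundedness of [h] on bounded subsets of the cone is what makes the infimum
    and the supremum of its values genuine bounds. *)
Lemma admissible_functional_range (h : ('I_n -> R -> R) -> R) u : 0 <= rho ->
  admissible_functional (cone a b c) h -> Kb u ->
  h u \in `[inf (h @` Kb), sup (h @` Kb)].
Proof.
move=> rho0 [_ _ hb] Ku.
have [r hr] := hb Kb (fun v Kv => Kv.1) (closed_cone_ball_bounded rho0).
rewrite in_itv/=; apply/andP; split.
- apply: ge_inf; last by exists u.
  by exists (- r) => _ [v Kv <-]; move: (hr v Kv); rewrite ler_norml => /andP[].
- apply: ub_le_sup; last by exists u.
  by exists r => _ [v Kv <-]; exact: le_trans (ler_norm _) (hr v Kv).
Qed.

End ClosedConeBall.

(** * Continuity of the superposition term *)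

Section Jet.
Context (R : realType) (n : nat).

Lemma cvg_mx (T : Type) (F : set_system T) (FF : Filter F) p q
    (g : T -> 'M[R]_(p, q)) (M : 'M[R]_(p, q)) :
  (forall i j, g x i j @[x --> F] --> M i j) -> g @ F --> M.
Proof.
move=> gM A [P nP PA].
have : \forall x \near F, forall i j, P i j (g x i j); last first.
  by apply: filterS => x; exact: PA.
apply: filter_forall => i; apply: filter_forall => j.
exact: gM (nP i j).
Qed.

Lemma jet_within_continuous (u : 'I_n -> R -> R) : (forall j, is_C1 (u j)) ->
  {within `[0, 1], continuous (jet u)}.
Proof.
move=> uC; apply/subspace_continuousP => t t01; apply: cvg_mx => i l.
case: (split_ordP l) => j ->.
- rewrite /jet row_mxEl mxE.
  under eq_fun do rewrite row_mxEl mxE.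
  by have /subspace_continuousP := is_C1_continuous (uC j); apply.
- rewrite /jet row_mxEr mxE.
  under eq_fun do rewrite row_mxEr mxE.
  by have /subspace_continuousP := (uC j).2; apply.
Qed.

Lemma superposition_within_continuous
    (f : R -> 'rV[R]_(n + n) -> R -> R) (u : 'I_n -> R -> R) y :
  {within `[0, 1] `*` [set: 'rV[R]_(n + n)] `*` `[0, +oo[,
    continuous (fun z : R * 'rV[R]_(n + n) * R => f z.1.1 z.1.2 z.2)} ->
  (forall j, is_C1 (u j)) -> 0 <= y ->
  {within `[0, 1], continuous (fun t => f t (jet u t) y)}.
Proof.
move=> /subspace_continuousP fC uC y0; apply/subspace_continuousP => t t01.
have D0 : (`[0, 1] `*` [set: 'rV[R]_(n + n)] `*` `[0, +oo[) (t, jet u t, y).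
  by split => //=; rewrite in_itv/= y0.
have /subspace_continuousP/(_ t t01) jC := jet_within_continuous uC.
have gC : (s, jet u s, y) @[s --> within `[0, 1] (nbhs t)] --> (t, jet u t, y).
  have sC : s @[s --> within `[0, 1] (nbhs t)] --> t by exact: cvg_within.
  exact: cvg_pair (cvg_pair sC jC) (cvg_cst y).
move=> A /(fC _ D0)/gC; rewrite /= !nbhs_filterE /within /= => gA.
apply: filterS gA => s gA s01; apply: gA => //.
by split => //=; rewrite in_itv/= y0.
Qed.

End Jet.

(** * Integration for the completed Lebesgue measure *)

Local Notation cleb_type R := (caratheodory_type (mu_ext (@wlength R idfun))).

Section CompletedLebesgue.
Context (R : realType).

Lemma cleb_measurable (A : set R) :
  measurable A -> measurable (A : set (cleb_type R)).
Proof. exact: sub_caratheodory. Qed.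

Lemma within_continuous_lebesgue_measurable (g : R -> R) :
  {within `[0, 1], continuous g} -> lebesgue_measurable_fun `[0, 1] g.
Proof.
move=> gC.
have mg := subspace_continuous_measurable_fun (measurable_itv `[0, 1]) gC.
by move=> _ Y mY; apply: cleb_measurable; apply: mg.
Qed.

Lemma integrable_mul_continuous (k g : R -> R) :
  leb.-integrable (`[0, 1] : set R) (EFin \o k) ->
  {within `[0, 1], continuous g} ->
  leb.-integrable (`[0, 1] : set R) (EFin \o (fun s => k s * g s)).
Proof.
move=> ki gC.
apply: (integrableMl (cleb_measurable (measurable_itv _)) ki).
- exact: within_continuous_lebesgue_measurable.
- exists (supnorm g); split; first exact: num_real.
  by move=> r gr s s01; apply: le_trans (ltW gr); exact: ler_supnorm.
Qed.

End CompletedLebesgue.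

(** * Upper and lower bounds for a solution of the scalar equation *)

Section HammersteinEquation.
Context (R : realType) (k : R -> R -> R) (Phi : R -> R) (a b ct : R).
Hypothesis k_measurable :
  forall t, t \in `[0, 1] -> lebesgue_measurable_fun `[0, 1] (k t).
Hypothesis Phi_integrable : leb.-integrable `[0, 1] (EFin \o Phi).
Hypothesis k_le_Phi : forall t, t \in `[0, 1] ->
  {ae leb, forall s : R, s \in `[0, 1] -> `|k t s| <= Phi s}.
Hypothesis ab01 : [/\ 0 <= a, a <= b & b <= 1].
Hypothesis ct01 : 0 < ct <= 1.
Hypothesis Phi_le_k : forall t, t \in `[a, b] ->
  {ae leb, forall s : R, s \in `[0, 1] -> ct * Phi s <= k t s}.

Let mI (x y : R) : measurable (`[x, y] : set (cleb_type R)).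
Proof. by apply: cleb_measurable; exact: measurable_itv. Qed.

Lemma subitv01 : `[a, b] `<=` (`[0, 1] : set R).
Proof.
move: ab01 => [a0 _ b1] s; rewrite /= !in_itv/= => /andP[as_ sb].
by rewrite (le_trans a0 as_) (le_trans sb b1).
Qed.

Lemma kernel_integrable t :
  t \in `[0, 1] -> leb.-integrable `[0, 1] (EFin \o k t).
Proof.
move=> t01.
apply: (integrable_ae_le (mI 0 1) (k_measurable t01) Phi_integrable).
exact: k_le_Phi.
Qed.

Lemma kernel_ae_ge0 t : t \in `[a, b] ->
  {ae leb, forall s : R, s \in `[0, 1] -> 0 <= k t s}.
Proof.
move=> tab.
apply: (ae_ge0_of_envelope _ (k_le_Phi (subitv01 tab)) (Phi_le_k tab)).
by case/andP: ct01 => /ltW.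
Qed.

(** The integral of [Phi] bounds all the integrals of which [inv_m0 k] is the
    supremum. *)
Lemma Rintegral_norm_kernel_le t : t \in `[0, 1] ->
  \int[leb]_(s in `[0, 1]) `|k t s| <= inv_m0 k.
Proof.
move=> t01; apply: ub_le_sup; last by exists t.
exists (\int[leb]_(s in `[0, 1]) Phi s) => _ [r r01 <-].
apply: (le_Rintegral_ae (mI 0 1)) => //; last exact: k_le_Phi.
exact: integrable_abse (kernel_integrable r01).
Qed.

Lemma Rintegral_kernel_ge t : t \in `[a, b] ->
  0 <= inv_M k a b <= \int[leb]_(s in `[a, b]) k t s.
Proof.
move=> tab.
have int0 r : r \in `[a, b] -> 0 <= \int[leb]_(s in `[a, b]) k r s.
  move=> rab; apply: (Rintegral_ae_ge0 (mI 0 1) (mI a b) subitv01).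
    exact: kernel_integrable (subitv01 rab).
  exact: kernel_ae_ge0.
apply/andP; split.
- apply: lb_le_inf; first by exists (\int[leb]_(s in `[a, b]) k t s), t.
  by move=> _ [r rab <-]; exact: int0.
- apply: ge_inf; last by exists t.
  by exists 0 => _ [r rab <-]; exact: int0.
Qed.

Context (lambda : R) (eta : 'I_2 -> R) (gamma : 'I_2 -> R -> R).
Context (g w : R -> R) (h : 'I_2 -> R).
Hypothesis lambda_ge0 : 0 <= lambda.
Hypothesis eta_ge0 : forall j, 0 <= eta j.
Hypothesis gamma_C1 : forall j, is_C1 (gamma j).
Hypothesis g_continuous : {within `[0, 1], continuous g}.
Hypothesis g_ge0 : forall s, s \in `[0, 1] -> 0 <= g s.
Hypothesis h_ge0 : forall j, 0 <= h j.
Hypothesis w_eq : forall t, t \in `[0, 1] ->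
  w t = lambda * \int[leb]_(s in `[0, 1]) (k t s * g s) +
        \sum_(j < 2) eta j * gamma j t * h j.

(** Meant for [m] the sup norm of [w]: the right-hand side is then a multiple
    of that norm, and a contraction factor forces it to vanish. *)
Lemma hammerstein_norm_le (xit : R) (xi : 'I_2 -> R) (m : R) :
  (forall s, s \in `[0, 1] -> g s <= xit * m) ->
  0 <= xit * m -> (forall j, h j <= xi j * m) ->
  forall t, t \in `[0, 1] ->
  `|w t| <= (lambda * xit * inv_m0 k +
             \sum_(j < 2) eta j * xi j * supnorm (gamma j)) * m.
Proof.
move=> g_le xm0 h_le t t01; rewrite w_eq// mulrDl.
apply: (le_trans (ler_normD _ _)); apply: lerD.
- rewrite normrM ger0_norm//.
  rewrite [leRHS](_ : _ = lambda * (xit * m * inv_m0 k)); last ring.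
  rewrite ler_wpM2l//.
  apply: (@le_trans _ _ (xit * m * \int[leb]_(s in `[0, 1]) `|k t s|)).
    apply: (normr_Rintegral_mul_le (mI 0 1)) => //.
    + exact: kernel_integrable.
    + exact: integrable_mul_continuous (kernel_integrable t01) g_continuous.
    + by move=> s s01; rewrite ger0_norm ?g_le ?g_ge0.
  by rewrite ler_wpM2l// Rintegral_norm_kernel_le.
- apply: (le_trans (ler_norm_sum _ _ _)).
  rewrite mulr_suml; apply: ler_sum => j _.
  rewrite normrM normrM (ger0_norm (eta_ge0 j)) (ger0_norm (h_ge0 j)).
  rewrite [leRHS](_ : _ = eta j * supnorm (gamma j) * (xi j * m)); last ring.
  apply: ler_pM => //; first by rewrite mulr_ge0.
  by rewrite ler_wpM2l// ler_supnorm//; exact: is_C1_continuous.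
Qed.

(** Meant for [m] the minimum of [w] over [a, b]: where it is attained,
    the bound compares a multiple of the minimum with the minimum itself. *)
Lemma hammerstein_ge (deltat : R) (delta cg : 'I_2 -> R) (m : R) :
  0 <= deltat -> (forall j, 0 <= delta j) -> 0 <= m ->
  (forall j, 0 <= cg j) ->
  (forall j t, t \in `[a, b] -> cg j * supnorm (gamma j) <= gamma j t) ->
  (forall s, s \in `[a, b] -> deltat * m <= g s) ->
  (forall j, delta j * m <= h j) ->
  forall t, t \in `[a, b] ->
  (lambda * deltat * ct * inv_M k a b +
   \sum_(j < 2) eta j * cg j * delta j * supnorm (gamma j)) * m <= w t.
Proof.
move=> dt0 d0 m0 cg0 gamma_ge g_ge h_ge t tab.
have t01 := subitv01 tab; rewrite w_eq// mulrDl; apply: lerD.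
- rewrite [leLHS](_ : _ = lambda * (deltat * m * (ct * inv_M k a b)));
    last ring.
  rewrite ler_wpM2l//.
  have /andP[M0 M_le] := Rintegral_kernel_ge tab.
  apply: (@le_trans _ _ (deltat * m * \int[leb]_(s in `[a, b]) k t s)).
    rewrite ler_wpM2l ?mulr_ge0//; apply: le_trans M_le.
    by rewrite ler_piMl//; case/andP: ct01.
  apply: (Rintegral_mul_ge (mI 0 1) (mI a b) subitv01) => //.
  + exact: kernel_integrable.
  + exact: integrable_mul_continuous (kernel_integrable t01) g_continuous.
  + exact: kernel_ae_ge0.
- rewrite mulr_suml; apply: ler_sum => j _.
  rewrite [leLHS](_ : _ =
    eta j * (cg j * supnorm (gamma j)) * (delta j * m)); last ring.
  have sg0 : 0 <= supnorm (gamma j).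
    by apply: le_trans (ler_supnorm (is_C1_continuous (gamma_C1 j)) t01).
  apply: ler_pM => //.
  + by rewrite !mulr_ge0.
  + by rewrite mulr_ge0.
  + by rewrite ler_wpM2l// gamma_ge.
Qed.

End HammersteinEquation.

(** * The nonexistence theorem *)

Theorem theorem2p6 (R : realType) (n : nat) (n_ge1 : (1 <= n)%N)
  (k : 'I_n -> R -> R -> R)
  (a b ct : 'I_n -> R) (cg : 'I_n -> 'I_2 -> R)
  (f : 'I_n -> R -> 'rV[R]_(n + n) -> R -> R)
  (gamma : 'I_n -> 'I_2 -> R -> R)
  (lambda : 'I_n -> R) (eta : 'I_n -> 'I_2 -> R)
  (h : 'I_n -> 'I_2 -> ('I_n -> R -> R) -> R)
  (w : 'I_n -> ('I_n -> R -> R) -> R)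
  (c := fun i => Num.min (ct i) (Num.min (cg i ord0) (cg i ord_max)))
  (K := cone a b c)
  (hC1 : forall i,
    (forall t, t \in `[0, 1] -> lebesgue_measurable_fun `[0, 1] (k i t)) /\
    (forall tau, tau \in `[0, 1] -> {ae leb, forall s : R, s \in `[0, 1] ->
       `|k i t s - k i tau s| @[t --> within `[0, 1] (nbhs tau)] --> (0 : R)}))
  (hab : forall i, [/\ 0 <= a i, a i <= b i & b i <= 1])
  (hct : forall i, 0 < ct i <= 1)
  (hC2 : forall i, exists Phi0 : R -> R,
    [/\ leb.-integrable `[0, 1] (EFin \o Phi0),
        forall t, t \in `[0, 1] -> {ae leb, forall s : R, s \in `[0, 1] ->
          `|k i t s| <= Phi0 s} &
        forall t, t \in `[a i, b i] -> {ae leb, forall s : R, s \in `[0, 1] ->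
          ct i * Phi0 s <= k i t s}])
  (hC3 : forall i,
    [/\ forall s t, s \in `[0, 1] -> t \in `[0, 1] -> t != s ->
          cvg (diffq01 (fun x => k i x s) t),
        forall t, t \in `[0, 1] ->
          lebesgue_measurable_fun `[0, 1] (dkdt (k i) t),
        forall s t, s \in `[0, 1] -> t \in `[0, 1] -> t != s ->
          dkdt (k i) x s @[x --> within `[0, 1] (nbhs t)] --> dkdt (k i) t s,
        forall s, s \in `[0, 1] ->
          (0 < s -> cvg (dkdt (k i) x s @[x --> s^'-])) /\
          (s < 1 -> cvg (dkdt (k i) x s @[x --> s^'+])) &
        exists Phi1 : R -> R, leb.-integrable `[0, 1] (EFin \o Phi1) /\
          forall t, t \in `[0, 1] -> {ae leb, forall s : R, s \in `[0, 1] ->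
            `|dkdt (k i) t s| <= Phi1 s}])
  (hC4 : forall i,
    {within `[0, 1] `*` [set: 'rV[R]_(n + n)] `*` `[0, +oo[,
      continuous (fun z : R * 'rV[R]_(n + n) * R => f i z.1.1 z.1.2 z.2)} /\
    forall t x y, t \in `[0, 1] -> 0 <= y -> 0 <= f i t x y)
  (hC5 : forall i j,
    [/\ is_C1 (gamma i j), 0 < cg i j <= 1 &
        forall t, t \in `[a i, b i] ->
          cg i j * supnorm (gamma i j) <= gamma i j t])
  (hC6 : forall i, 0 <= lambda i /\ forall j, 0 <= eta i j)
  (hC7 : forall i j, admissible_functional K (h i j))
  (hC8 : forall i, admissible_functional K (w i))
  (I J : {set 'I_n})
  (hIJ : I :&: J = finset.set0) (hIJT : I :|: J = finset.setT)
  (rho : R) (rho_gt0 : 0 < rho)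
  (Kb := closed_cone_ball a b c rho)
  (hNI : exists (xit : 'I_n -> R) (xi : 'I_n -> 'I_2 -> R),
    [/\ forall i, 0 <= xit i /\ forall j, 0 <= xi i j,
        forall i, i \in I ->
          (forall (t : R) (x : 'rV[R]_(n + n)) (y : R), t \in `[0, 1] ->
             (forall l, x ord0 l \in `[- rho, rho]) ->
             y \in `[inf (w i @` Kb), sup (w i @` Kb)] ->
             f i t x y <= xit i * `|x ord0 (lshift n i)|) /\
          (forall u, Kb u -> forall j, h i j u <= xi i j * supnorm (u i)) &
        (\big[Order.max/-oo]_(i in I)
           (lambda i * xit i * inv_m0 (k i) +
            \sum_(j < 2) eta i j * xi i j * supnorm (gamma i j))%:E < 1)%E])
  (hNJ : exists (deltat : 'I_n -> R) (delta : 'I_n -> 'I_2 -> R),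
    [/\ forall i, 0 <= deltat i /\ forall j, 0 <= delta i j,
        forall i, i \in J ->
          (forall (t : R) (x : 'rV[R]_(n + n)) (y : R), t \in `[a i, b i] ->
             (forall l, x ord0 l \in
                `[(if l == lshift n i then 0 else -1) * rho, rho]) ->
             y \in `[inf (w i @` Kb), sup (w i @` Kb)] ->
             deltat i * x ord0 (lshift n i) <= f i t x y) /\
          (forall u, Kb u -> forall j, delta i j * supnorm (u i) <= h i j u) &
        (1 < \big[Order.min/+oo]_(i in J)
           (lambda i * deltat i * ct i * inv_M (k i) (a i) (b i) +
            \sum_(j < 2)
              eta i j * cg i j * delta i j * supnorm (gamma i j))%:E)%E]) :
  forall u : 'I_n -> R -> R, Kb u ->
    (forall i t, t \in `[0, 1] ->
       u i t = lambda i *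
           \int[leb]_(s in `[0, 1]) (k i t s * f i s (jet u s) (w i u)) +
         \sum_(j < 2) eta i j * gamma i j t * h i j u) ->
    forall i t, t \in `[0, 1] -> u i t = 0.
Proof.
move=> u Ku u_eq i; have [uK _] := Ku.
have uC j : is_C1 (u j) by exact: (uK j).1.
have rho0 := ltW rho_gt0.
have [Phi [Phi_int k_le Phi_le]] := hC2 i.
have [k_meas _] := hC1 i.
have [lambda0 eta0] := hC6 i.
have gammaC j : is_C1 (gamma i j) by case: (hC5 i j).
have [w0 _ _] := hC8 i; have wu0 : 0 <= w i u := w0 _ uK.
have wu_range := admissible_functional_range rho0 (hC8 i) Ku.
have h0 j : 0 <= h i j u by case: (hC7 i j) => + _ _; apply.
have [f_cont f_ge0] := hC4 i.
have g_cont := superposition_within_continuous f_cont uC wu0.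
have g_ge0 s : s \in `[0, 1] -> 0 <= f i s (jet u s) (w i u).
  by move=> s01; exact: f_ge0.
have ct01 := hct i; have [a0 ab b1] := hab i.
have c0 : 0 < c i.
  have [_ /andP[cg0 _] _] := hC5 i ord0.
  have [_ /andP[cg1 _] _] := hC5 i ord_max.
  by rewrite !lt_min cg0 cg1; case/andP: ct01 => ->.
have jetE s : jet u s ord0 (lshift n i) = u i s by rewrite /jet row_mxEl mxE.
have ui_le s : s \in `[0, 1] -> `|u i s| <= supnorm (u i).
  by move=> s01; apply: ler_supnorm => //; exact: is_C1_continuous.
have m0 : 0 <= supnorm (u i).
  by apply: le_trans (ui_le 0 _); rewrite ?in_itv/= ?lexx ?ler01.
suff u0 : supnorm (u i) <= 0.
  move=> t t01; apply/eqP; rewrite -normr_le0; exact: le_trans (ui_le t t01) u0.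
have : i \in I :|: J by rewrite hIJT inE.
rewrite inE => /orP[iI|iJ].
- have [xit [xi [xi0 NI q1]]] := hNI.
  have {NI}[f_le h_le] := NI i iI.
  have qi1 := (bigmax_ltP _ _ _ _ q1).2 i iI; rewrite lte_fin in qi1.
  set q := (X in X < 1) in qi1.
  have u_le t : t \in `[0, 1] -> `|u i t| <= q * supnorm (u i).
    apply: (hammerstein_norm_le k_meas Phi_int k_le lambda0 eta0 gammaC g_cont
      g_ge0 h0 (u_eq i)); last exact: h_le.
    - move=> s s01.
      have [xit0 _] := xi0 i.
      apply: (@le_trans _ _ (xit i * `|u i s|)); last first.
        by rewrite ler_wpM2l ?ui_le.
      rewrite -jetE; apply: f_le => // l.
      by rewrite in_itv/= -ler_norml; apply: closed_cone_ball_jet Ku s01.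
    - by rewrite mulr_ge0//; case: (xi0 i).
  have := supnorm_le u_le; nra.
- have [deltat [delta [delta0 NJ q1]]] := hNJ.
  have {NJ}[f_ge h_ge] := NJ i iJ.
  have qi1 := (bigmin_gtP _ _ _ _ q1).2 i iJ; rewrite lte_fin in qi1.
  set q := (X in _ < X) in qi1.
  have [deltat0 deltaj0] := delta0 i.
  have u_cone s : s \in `[a i, b i] -> c i * supnorm (u i) <= u i s.
    by move=> sab; exact: (cone_ge a0 b1 uK sab).
  have u_cont : {within `[a i, b i], continuous u i}.
    by apply: continuous_subspaceW (is_C1_continuous (uC i)); exact: subitv01.
  have [t0 t0ab u_min] := EVT_min ab u_cont.
  have u_ge0 s : s \in `[a i, b i] -> 0 <= u i s.
    by move=> sab; apply: le_trans (u_cone s sab); rewrite mulr_ge0// ltW.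
  have ut0 : q * u i t0 <= u i t0.
    apply: (hammerstein_ge k_meas Phi_int k_le (hab i) ct01 Phi_le lambda0 eta0
      gammaC g_cont g_ge0 (u_eq i)) => //.
    - exact: u_ge0.
    - by move=> j; have [_ /andP[/ltW-> _] _] := hC5 i j.
    - by move=> j; have [_ _ +] := hC5 i j; exact.
    - move=> s sab; apply: (@le_trans _ _ (deltat i * u i s)).
        by rewrite ler_wpM2l ?u_min.
      (* The sign of [u i] is needed only on [a i, b i], where the cone
         condition provides it; the other coordinates only obey the bound
         by [rho]. *)
      rewrite -jetE; apply: f_ge => // l.
      have /= := closed_cone_ball_jet l Ku (subitv01 (hab i) sab).
      rewrite ler_norml in_itv/= => /andP[ge_rho ->]; rewrite andbT.
      case: eqP => [->|_]; last by rewrite mulN1r.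
      by rewrite mul0r jetE u_ge0.
    (* The functionals are bounded below through the norm of [u i], which
       dominates its minimum. *)
    - move=> j; apply: le_trans (h_ge u Ku j); rewrite ler_wpM2l//.
      apply: le_trans (ui_le _ (subitv01 (hab i) t0ab)); exact: ler_norm.
  have ut0_le0 : u i t0 <= 0 by nra.
  by rewrite -(pmulr_rle0 _ c0) (le_trans (u_cone t0 t0ab)).
Qed.
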